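(* Ambiguous çarks correspond to ambiguous forms: a çark $\mathcal{C}$ is ambiguous (that is, $\mathcal{C}$ and $\mathcal{C}^{r}$ are isomorphic as çarks) if and only if the forms in the class represented by $\mathcal{C}$ are ambiguous.
   Context: Let $S(z)=-1/z$, $R(z)=(z-1)/z$. The bipartite Farey tree $\mathcal{F}$ has edges $\{W\}$, $\otimes$-vertices $\{W,WS\}$, $\bullet$-vertices $\{W,WR,WR^2\}$ ($W\in\mathrm{PSL}_2(\mathbf{Z})$); the edge $\{W\}$ joins $\{W,WS\}$ to $\{W,WR,WR^2\}$. $\mathrm{PSL}_2(\mathbf{Z})$ acts on it by left multiplication. $\mathcal{F}$ is realized in the upper half plane $\mathcal{H}$ as the orbit of the geodesic arc from $i$ (the vertex $\{I,S\}$) to $e^{i\pi/3}$ (the vertex $\{I,R,R^2\}$). A çark is $\langle M\rangle\backslash\mathcal{F}$ with $M\in \mathrm{PSL}_2(\mathbf{Z})$ hyperbolic, embedded in the annulus $\langle M\rangle\backslash\mathcal{H}$; its unique circuit, the image of the axis of $M$ in $\mathcal{F}$, is the spine, directed by the translation direction of $M$. The annulus is viewed, compatibly with orientation, as a round annulus in the plane with the spine running counterclockwise, so the inner boundary is to the left of the directed spine. All çarks here are considered with this convention, and isomorphisms of çarks preserve the ribbon structure and the direction of the spine (hence inner and outer boundary). At each $\bullet$-vertex of the spine an infinite Farey branch is attached, going to the inner or the outer boundary. A çark is thus determined by the cyclic word in the letters ''inner'', ''outer'' read along the counterclockwise spine. $\mathcal{C}^r$ is the mirror image of $\mathcal{C}$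 about a line through the centre of the spine (branches drawn evenly spaced): the cyclic word is reversed, inner/outer are kept, and the spine is again directed counterclockwise. $\mathcal{C}$ is ambiguous if $\mathcal{C}\cong\mathcal{C}^r$. Forms: $(A,B,C)$ denotes $Ax^2+Bxy+Cy^2$ with $A,B,C\in\mathbf{Z}$, and $\mathrm{PSL}_2(\mathbf{Z})$ acts by $(U\cdot f)(x,y)=f(U(x,y)^t)$; classes are orbits. For hyperbolic $M=\begin{pmatrix}p&q\\ r&s\end{pmatrix}$ put $f_M=\frac{\mathrm{sgn}(p+s)}{\gcd(q,s-p,r)}(r,s-p,-q)$, a primitive indefinite form; the çark $\langle M\rangle\backslash\mathcal{F}$ directed by $M$ represents the class $[f_M]$. The inverse of the class of $(A,B,C)$ is the class of $(A,-B,C)$. A form is ambiguous if it is equivalent to its inverse, or equivalently if its class contains a form $(a,ka,c)$ with $a,c,k\in\mathbf{Z}$. *)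

(* Defs.v *)
From HB Require Import structures.
From mathcomp Require Import all_boot all_order all_algebra generic_quotient.
From mathcomp Require Import boolp classical_sets.
From mathcomp Require Import ring.

Set Implicit Arguments.
Unset Strict Implicit.
Unset Printing Implicit Defensive.

Import GRing.Theory Num.Theory.
Local Open Scope ring_scope.
Local Open Scope quotient_scope.

Record SL2Z := MkSL2 { sl2mx :> 'M[int]_2; sl2_det : \det sl2mx == 1 }.
HB.instance Definition _ := [isSub for sl2mx].
HB.instance Definition _ := [Choice of SL2Z by <:].

Lemma sl2_mul_subproof (A B : SL2Z) : \det (sl2mx A *m sl2mx B) == 1.
Proof. by rewrite det_mulmx (eqP (sl2_det A)) (eqP (sl2_det B)) mulr1. Qed.

Lemma sl2_inv_subproof (A : SL2Z) : \det (\adj (sl2mx A)) == 1.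
Proof.
have := congr1 determinant (mul_mx_adj (sl2mx A)).
by rewrite det_mulmx (eqP (sl2_det A)) mul1r det1 => ->.
Qed.

Lemma sl2_one_subproof : \det (1%:M : 'M[int]_2) == 1.
Proof. by rewrite det1. Qed.

Definition sl2_mul (A B : SL2Z) : SL2Z := MkSL2 (sl2_mul_subproof A B).
Definition sl2_inv (A : SL2Z) : SL2Z := MkSL2 (sl2_inv_subproof A).
Definition sl2_one : SL2Z := MkSL2 sl2_one_subproof.

Lemma sl2_mulA : associative sl2_mul.
Proof. by move=> A B C; apply: val_inj; rewrite /= mulmxA. Qed.
Lemma sl2_mul1 : left_id sl2_one sl2_mul.
Proof. by move=> A; apply: val_inj; rewrite /= mul1mx. Qed.
Lemma sl2_mul1r : right_id sl2_one sl2_mul.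
Proof. by move=> A; apply: val_inj; rewrite /= mulmx1. Qed.
Lemma sl2_mulV : left_inverse sl2_one sl2_inv sl2_mul.
Proof.
by move=> A; apply: val_inj; rewrite /= mul_adj_mx (eqP (sl2_det A)).
Qed.
Lemma sl2_mulVr : right_inverse sl2_one sl2_inv sl2_mul.
Proof.
by move=> A; apply: val_inj; rewrite /= mul_mx_adj (eqP (sl2_det A)).
Qed.

HB.instance Definition _ :=
  isGroup.Build SL2Z sl2_mulA sl2_mul1 sl2_mul1r sl2_mulV sl2_mulVr.

Definition eq_up_to_sign (A B : SL2Z) : bool :=
  (sl2mx A == sl2mx B) || (sl2mx A == - sl2mx B).

Lemma eq_up_to_sign_refl : reflexive eq_up_to_sign.
Proof. by move=> A; rewrite /eq_up_to_sign eqxx. Qed.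
Lemma eq_up_to_sign_sym : symmetric eq_up_to_sign.
Proof. by move=> A B; rewrite /eq_up_to_sign eq_sym -eqr_oppLR (eq_sym (- _)). Qed.
Lemma eq_up_to_sign_trans : transitive eq_up_to_sign.
Proof.
move=> B A C; rewrite /eq_up_to_sign => /orP[]/eqP-> /orP[]/eqP->;
  by rewrite ?opprK eqxx ?orbT.
Qed.

Canonical eq_up_to_sign_equiv := EquivRel eq_up_to_sign
  eq_up_to_sign_refl eq_up_to_sign_sym eq_up_to_sign_trans.

Definition PSL2Z := {eq_quot eq_up_to_sign}.
HB.instance Definition _ := Choice.on PSL2Z.
HB.instance Definition _ := EqQuotient.on PSL2Z.

Definition psl (A : SL2Z) : PSL2Z := \pi_PSL2Z A.

Lemma psl_eqP (A B : SL2Z) :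
  psl A = psl B <-> sl2mx A = sl2mx B \/ sl2mx A = - sl2mx B.
Proof.
split=> [/eqmodP/orP[]/eqP|AB]; [by left|by right|].
by apply/eqmodP/orP; case: AB => ->; rewrite eqxx; [left|right].
Qed.

Lemma repr_psl (A : SL2Z) :
  sl2mx (repr (psl A)) = sl2mx A \/ sl2mx (repr (psl A)) = - sl2mx A.
Proof. by apply/psl_eqP; rewrite /psl reprK. Qed.

Definition psl_mul (X Y : PSL2Z) : PSL2Z := psl (sl2_mul (repr X) (repr Y)).
Definition psl_inv (X : PSL2Z) : PSL2Z := psl (sl2_inv (repr X)).
Definition psl_one : PSL2Z := psl sl2_one.

Lemma psl_mulE A B : psl_mul (psl A) (psl B) = psl (sl2_mul A B).
Proof.
apply/psl_eqP => /=; case: (repr_psl A) => ->; case: (repr_psl B) => ->;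
  rewrite ?mulNmx ?mulmxN ?opprK; by [left|right].
Qed.

Lemma sl2_invP (A B : SL2Z) : sl2_mul A B = sl2_one -> B = sl2_inv A.
Proof.
by move=> AB; rewrite -[RHS]sl2_mul1r -AB sl2_mulA sl2_mulV sl2_mul1.
Qed.

Lemma psl_invE A : psl_inv (psl A) = psl (sl2_inv A).
Proof.
have adjN (B C : SL2Z) : sl2mx B = - sl2mx C -> \adj (sl2mx B) = - \adj (sl2mx C).
  move=> BC; rewrite -[LHS]mulmx1 -(eqP (sl2_det C)) -mul_mx_adj mulmxA.
  by rewrite -[sl2mx C]opprK -BC mulmxN mul_adj_mx (eqP (sl2_det B)) mulNmx mul1mx BC opprK.
apply/psl_eqP => /=; case: (repr_psl A) => [->|/adjN]; by [left|right].
Qed.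

Lemma pslP (P : PSL2Z -> Prop) : (forall A, P (psl A)) -> forall X, P X.
Proof. by move=> PA X; rewrite -[X]reprK; apply: PA. Qed.

Lemma psl_mulA : associative psl_mul.
Proof.
elim/pslP=> A; elim/pslP=> B; elim/pslP=> C.
by rewrite !psl_mulE sl2_mulA.
Qed.
Lemma psl_mul1 : left_id psl_one psl_mul.
Proof. by elim/pslP=> A; rewrite psl_mulE sl2_mul1. Qed.
Lemma psl_mul1r : right_id psl_one psl_mul.
Proof. by elim/pslP=> A; rewrite psl_mulE sl2_mul1r. Qed.
Lemma psl_mulV : left_inverse psl_one psl_inv psl_mul.
Proof. by elim/pslP=> A; rewrite psl_invE psl_mulE sl2_mulV. Qed.
Lemma psl_mulVr : right_inverse psl_one psl_inv psl_mul.
Proof. by elim/pslP=> A; rewrite psl_invE psl_mulE sl2_mulVr. Qed.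

HB.instance Definition _ :=
  isGroup.Build PSL2Z psl_mulA psl_mul1 psl_mul1r psl_mulV psl_mulVr.

Definition mx2 (a b c d : int) : 'M[int]_2 :=
  \matrix_(i, j) (if i == 0 then if j == 0 then a else b
                  else if j == 0 then c else d).

Lemma det_mx2 a b c d : \det (mx2 a b c d) = a * d - b * c.
Proof.
rewrite (expand_det_row _ 0) !big_ord_recl big_ord0 /cofactor !det_mx11 !mxE /=.
ring.
Qed.

Lemma matS_subproof : \det (mx2 0 (-1) 1 0) == 1.
Proof. by rewrite det_mx2. Qed.
Lemma matR_subproof : \det (mx2 1 (-1) 1 0) == 1.
Proof. by rewrite det_mx2. Qed.

(* The Moebius maps z |-> -1/z and z |-> (z-1)/z. *)
Definition matS : PSL2Z := psl (MkSL2 matS_subproof).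
Definition matR : PSL2Z := psl (MkSL2 matR_subproof).

Lemma matS2 : (matS * matS)%g = 1%g.
Proof.
rewrite [LHS]psl_mulE; apply/psl_eqP; right; apply/matrixP => i j.
rewrite !mxE big_ord_recl big_ord1 !mxE.
by move: i j => [[|[|//]] ?] [[|[|//]] ?].
Qed.

Lemma matR3 : (matR * matR * matR)%g = 1%g.
Proof.
rewrite [(matR * matR)%g]psl_mulE [LHS]psl_mulE.
apply/psl_eqP; right; apply/matrixP => i j.
rewrite !mxE !big_ord_recl !big_ord0 !mxE !big_ord_recl !big_ord0 !mxE.
by move: i j => [[|[|//]] ?] [[|[|//]] ?].
Qed.

(* A bipartite ribbon graph, encoded by its edges and the cyclic orders at the
   vertices: [swap e] is the other edge at the $\otimes$-vertex of [e], and
   [rot e] is the edge that follows [e] clockwise at its $\bullet$-vertex.  The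
   vertices are the orbits of [swap] and of [rot]. *)
Record ribbon := Ribbon {
  edge : Type;
  swap : edge -> edge;
  rot : edge -> edge;
  swap2 : forall e, swap (swap e) = e;
  rot3 : forall e, rot (rot (rot e)) = e }.

Definition otimes_vertex (G : ribbon) (e : edge G) : edge G -> Prop :=
  fun e' => e' = e \/ e' = swap e.

Definition bullet_vertex (G : ribbon) (e : edge G) : edge G -> Prop :=
  fun e' => [\/ e' = e, e' = rot e | e' = rot (rot e)].

(* An edge with a direction of travel: [(e, true)] runs from the
   $\otimes$-vertex of [e] to its $\bullet$-vertex, [(e, false)] runs back. *)
Definition dart (G : ribbon) : Type := (edge G * bool)%type.

(* Two consecutive darts of a path without backtracking. *)
Definition step (G : ribbon) (d d' : dart G) : Prop :=
  [/\ d'.2 = ~~ d.2, d'.1 <> d.1 &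
      if d.2 then bullet_vertex d.1 d'.1 else otimes_vertex d.1 d'.1].

Lemma reverse_rot3 (G : ribbon) (e : edge G) :
  let r x := rot (rot x) in r (r (r e)) = e.
Proof. by rewrite /= !rot3. Qed.

Definition reverse_ribbon (G : ribbon) : ribbon :=
  @Ribbon (edge G) (@swap G) (fun e => rot (rot e)) (@swap2 G)
          (@reverse_rot3 G).

Lemma farey_swap2 (W : PSL2Z) : (W * matS * matS = W)%g.
Proof. by rewrite -mulgA matS2 mulg1. Qed.
Lemma farey_rot3 (W : PSL2Z) : (W * matR * matR * matR = W)%g.
Proof. by rewrite -!mulgA (mulgA matR matR) matR3 mulg1. Qed.

(* The Moebius map R rotates the upper half plane clockwise by 2 pi/3 about
   e^{i pi/3} (its derivative there is e^{-2 i pi/3}), hence W, WR, WR^2 is the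
   clockwise order of the edges at the $\bullet$-vertex of {W}. *)
Definition farey : ribbon :=
  @Ribbon PSL2Z (fun W => W * matS)%g (fun W => W * matR)%g
          farey_swap2 farey_rot3.

Definition cyclic_subgroup (M : PSL2Z) (X : PSL2Z) : Prop :=
  exists n : nat, X = (M ^+ n)%g \/ X = (M ^- n)%g.

Definition same_coset (M W W' : PSL2Z) : bool :=
  `[< exists2 X, cyclic_subgroup M X & W' = (X * W)%g >].

Lemma cyclic_subgroup1 M : cyclic_subgroup M 1%g.
Proof. by exists 0; left; rewrite expg0. Qed.

Lemma cyclic_subgroupV M X : cyclic_subgroup M X -> cyclic_subgroup M X^-1%g.
Proof. by case=> n [->|->]; exists n; [right|left; rewrite invgK]. Qed.

Lemma cyclic_subgroupM M X Y :
  cyclic_subgroup M X -> cyclic_subgroup M Y -> cyclic_subgroup M (X * Y)%g.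
Proof.
have mixed m n : cyclic_subgroup M (M ^+ m * M ^- n)%g.
  have [le_nm|/ltnW le_mn] := leqP n m.
    by exists (m - n)%N; left; rewrite -{1}(subnK le_nm) expgnDr mulgK.
  exists (n - m)%N; right.
  by rewrite -{1}(subnK le_mn) expgnDr invgM mulgA mulgV mul1g.
case=> m [->|->] [n [->|->]].
- by exists (m + n)%N; left; rewrite expgnDr.
- exact: mixed.
- have := cyclic_subgroupV (mixed m n); rewrite invgM invgK.
  suff -> : (M ^+ n * M ^- m = M ^- m * M ^+ n)%g by [].
  apply: (mulgI (M ^+ m)%g); rewrite mulVKg mulgA -expgnDr addnC expgnDr.
  by rewrite mulgK.
- by exists (n + m)%N; right; rewrite expgnDr invgM.
Qed.

Lemma same_coset_refl M : reflexive (same_coset M).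
Proof.
by move=> W; apply/asboolP; exists 1%g; [exact: cyclic_subgroup1|rewrite mul1g].
Qed.
Lemma same_coset_sym M : symmetric (same_coset M).
Proof.
suff imp W W' : same_coset M W W' -> same_coset M W' W.
  by move=> W W'; apply/idP/idP; apply: imp.
move=> /asboolP[X MX ->]; apply/asboolP; exists X^-1%g.
  exact: cyclic_subgroupV.
by rewrite mulKg.
Qed.
Lemma same_coset_trans M : transitive (same_coset M).
Proof.
move=> W' W W'' /asboolP[X MX ->] /asboolP[Y MY ->]; apply/asboolP.
by exists (Y * X)%g; [exact: cyclic_subgroupM|rewrite mulgA].
Qed.

Canonical same_coset_equiv M := EquivRel (same_coset M)
  (same_coset_refl M) (@same_coset_sym M) (@same_coset_trans M).

(* <M> acts by left multiplication, [swap] and [rot] by right multiplication, so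
   the vertices of <M>\F, the <M>-orbits of vertices, are again the orbits of
   the induced [swap] and [rot]. *)
Definition orbit_edge (M : PSL2Z) := {eq_quot (same_coset M)}.

Definition proj (M : PSL2Z) (W : edge farey) : orbit_edge M :=
  \pi_(orbit_edge M) W.

Lemma projP M (W W' : edge farey) :
  proj M W = proj M W' <->
  exists2 X, cyclic_subgroup M X & W' = (X * W)%g.
Proof. by split=> [/eqmodP/asboolP|h]; [|apply/eqmodP/asboolP]. Qed.

Definition orbit_swap M (x : orbit_edge M) : orbit_edge M :=
  proj M (@swap farey (repr x)).
Definition orbit_rot M (x : orbit_edge M) : orbit_edge M :=
  proj M (@rot farey (repr x)).

Lemma orbit_swapE M W : orbit_swap (proj M W) = proj M (@swap farey W).
Proof.
have /projP[X MX EX] : proj M (repr (proj M W)) = proj M W by rewrite /proj reprK.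
by apply/projP; exists X; rewrite //= {1}EX mulgA.
Qed.

Lemma orbit_rotE M W : orbit_rot (proj M W) = proj M (@rot farey W).
Proof.
have /projP[X MX EX] : proj M (repr (proj M W)) = proj M W by rewrite /proj reprK.
by apply/projP; exists X; rewrite //= {1}EX mulgA.
Qed.

Lemma orbit_swap2 M (x : orbit_edge M) : orbit_swap (orbit_swap x) = x.
Proof. by rewrite -[x]reprK -/(proj M _) !orbit_swapE swap2. Qed.
Lemma orbit_rot3 M (x : orbit_edge M) : orbit_rot (orbit_rot (orbit_rot x)) = x.
Proof. by rewrite -[x]reprK -/(proj M _) !orbit_rotE rot3. Qed.

Definition quotient_farey (M : PSL2Z) : ribbon :=
  @Ribbon (orbit_edge M) (@orbit_swap M) (@orbit_rot M)
          (@orbit_swap2 M) (@orbit_rot3 M).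

Definition hyperbolic (M : PSL2Z) : Prop := 2 < `|\tr (sl2mx (repr M))|.

Lemma hyperbolic_psl A : hyperbolic (psl A) <-> 2 < `|\tr (sl2mx A)|.
Proof.
by rewrite /hyperbolic; case: (repr_psl A) => ->; rewrite ?raddfN ?normrN.
Qed.

(* The darts of the axis of M in the Farey tree, directed by the translation:
   those of a bi-infinite path without backtracking which M moves forward along
   itself by some k > 0. *)
Definition on_axis (M : PSL2Z) (d : dart farey) : Prop :=
  exists (path : int -> dart farey) (k : nat),
    [/\ (0 < k)%N,
        forall n, step (path n) (path (n + 1)),
        forall n, path (n + k%:Z) = ((M * (path n).1)%g, (path n).2) &
        path 0 = d].

(* A ribbon graph with a directed spine, given by the darts it traverses.  Drawn
   in the annulus with the spine counterclockwise, the inner boundary is to the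
   left of the spine. *)
Record cark := Cark {
  graph :> ribbon;
  spine : dart graph -> Prop }.

(* <M>\F, directed by M. *)
Definition cark_of (M : PSL2Z) : cark :=
  @Cark (quotient_farey M)
    (fun d => exists W : edge farey, proj M W = d.1 /\ on_axis M (W, d.2)).

Definition cark_iso (C D : cark) : Prop :=
  exists phi : edge C -> edge D,
    [/\ bijective phi,
        forall e, phi (swap e) = swap (phi e),
        forall e, phi (rot e) = rot (phi e) &
        forall e b, spine (e, b) <-> spine (phi e, b)].

(* The mirror image about a line through the centre of the spine.  The
   reflection inverts the cyclic orders and makes the spine run clockwise;
   directing it counterclockwise again reverses all its darts. *)
Definition mirror (C : cark) : cark :=
  @Cark (reverse_ribbon C) (fun d => spine (d.1, ~~ d.2) : Prop).

(* The spine reaches a $\bullet$-vertex along [e] and leaves it along [e'].  As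
   [rot] is clockwise, [rot e] lies to the left and [rot (rot e)] to the right
   of the spine, so the branch at this vertex is inner when the spine turns
   right, and outer when it turns left. *)
Definition inner_branch (C : cark) (e e' : edge C) : Prop :=
  [/\ spine (e, true), spine (e', false), e' <> e & e' = rot (rot e)].
Definition outer_branch (C : cark) (e e' : edge C) : Prop :=
  [/\ spine (e, true), spine (e', false), e' <> e & e' = rot e].

(* The mirror image runs through the $\bullet$-vertices in the reverse order and
   keeps the letters inner and outer. *)
Lemma mirror_inner (C : cark) (e e' : edge C) :
  @inner_branch (mirror C) e' e <-> @inner_branch C e e'.
Proof.
split=> [[/= se' se ne E]|[se se' ne E]]; split=> //=.
- by move=> h; apply: ne.
- by rewrite E !rot3.
- by move=> h; apply: ne.
- by rewrite E !rot3.
Qed.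

Lemma mirror_outer (C : cark) (e e' : edge C) :
  @outer_branch (mirror C) e' e <-> @outer_branch C e e'.
Proof.
split=> [[/= se' se ne E]|[se se' ne E]]; split=> //=.
- by move=> h; apply: ne.
- by rewrite E rot3.
- by move=> h; apply: ne.
- by rewrite E rot3.
Qed.

Definition ambiguous_cark (C : cark) : Prop := cark_iso C (mirror C).

Record form := Form { coefA : int; coefB : int; coefC : int }.

Definition form_eval (f : form) (x y : int) : int :=
  coefA f * x ^+ 2 + coefB f * x * y + coefC f * y ^+ 2.

Definition sl2_act (U : SL2Z) (f : form) : form :=
  let u i j := sl2mx U i j in
  Form (form_eval f (u 0 0) (u 1 0))
       (2 * coefA f * u 0 0 * u 0 1
        + coefB f * (u 0 0 * u 1 1 + u 0 1 * u 1 0)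
        + 2 * coefC f * u 1 0 * u 1 1)
       (form_eval f (u 0 1) (u 1 1)).

Lemma sl2_actE (U : SL2Z) f x y :
  form_eval (sl2_act U f) x y =
  form_eval f (sl2mx U 0 0 * x + sl2mx U 0 1 * y)
              (sl2mx U 1 0 * x + sl2mx U 1 1 * y).
Proof. by rewrite /sl2_act /form_eval /=; ring. Qed.

Definition form_act (U : PSL2Z) (f : form) : form := sl2_act (repr U) f.

Lemma form_act_psl A f : form_act (psl A) f = sl2_act A f.
Proof.
rewrite /form_act /sl2_act /form_eval.
by case: (repr_psl A) => -> //; rewrite !mxE; congr Form; ring.
Qed.

Definition form_equiv (f g : form) : Prop := exists U, g = form_act U f.

Definition form_inv (f : form) : form :=
  Form (coefA f) (- coefB f) (coefC f).

Definition ambiguous_form (f : form) : Prop := form_equiv f (form_inv f).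

Definition sl2_form (A : SL2Z) : form :=
  let p := sl2mx A 0 0 in let q := sl2mx A 0 1 in
  let r := sl2mx A 1 0 in let s := sl2mx A 1 1 in
  let d := gcdz q (gcdz (s - p) r) in
  let sg := sgz (p + s) in
  Form (sg * (r %/ d)%Z) (sg * ((s - p) %/ d)%Z) (sg * ((- q) %/ d)%Z).

Definition form_of (M : PSL2Z) : form := sl2_form (repr M).

Lemma divNz (d m : int) : (d %| m)%Z -> ((- m) %/ d)%Z = - (m %/ d)%Z.
Proof.
case: (eqVneq d 0) => [->|d0 /dvdzP[k ->]]; first by rewrite !divz0.
by rewrite -mulNr !mulzK.
Qed.

Lemma form_of_psl A : form_of (psl A) = sl2_form A.
Proof.
rewrite /form_of /sl2_form; case: (repr_psl A) => -> //; rewrite !mxE.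
set p := sl2mx A 0 0; set q := sl2mx A 0 1.
set r := sl2mx A 1 0; set s := sl2mx A 1 1.
have -> : - s - - p = - (s - p) by ring.
have -> : - p - s = - (p + s) by ring.
rewrite !(gcdNz, gcdzN) sgzN; set d := gcdz q _.
have dq : (d %| q)%Z by exact: dvdz_gcdl.
have ds : (d %| s - p)%Z.
  by apply: dvdz_trans (dvdz_gcdr _ _) (dvdz_gcdl _ _).
have dr : (d %| r)%Z by apply: dvdz_trans (dvdz_gcdr _ _) (dvdz_gcdr _ _).
by rewrite opprK (divNz dq) (divNz ds) (divNz dr) !(mulNr, mulrN) !opprK.
Qed.

(* f lies in the class represented by the cark <M>\F directed by M. *)
Definition represents (M : PSL2Z) (f : form) : Prop :=
  form_equiv (form_of M) f.

(* Main.v *)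
From mathcomp Require Import all_boot all_order all_algebra generic_quotient.
From mathcomp Require Import boolp zify ring.
Require Import Defs.

(* Let [flip] be the conjugation by [[0, 1], [1, 0]]; it fixes S and inverts R,
   so that W |-> flip W realizes the mirror image of the Farey tree.  As S and R
   generate PSL_2(Z), an isomorphism of <M>\F onto its mirror image lifts to
   W |-> U flip(W) for some U, and it exists iff U conjugates flip M to M^-1:
   the bijection on cosets forces U flip(M) U^-1 to generate <M>, hence to be M
   or M^-1, and the direction of the spine excludes M.  The latter uses that a
   hyperbolic M has an axis and that the axis has one direction only.  Both facts
   come from words in RS and R^2 S, which are nonnegative matrices up to sign:
   every hyperbolic M is conjugate to a nonempty such word, and none of these is
   the identity.
   On the side of forms, U.f_M = f_N with N = U^-1 M U, the inverse of f_M is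
   equivalent to f_N with N = flip(M)^-1, and f_M determines M once |tr M| is
   known; so f_M is ambiguous iff M and flip(M)^-1 are conjugate. *)

Set Implicit Arguments.
Unset Strict Implicit.
Unset Printing Implicit Defensive.

Import Order.TTheory GRing.Theory Num.Theory.
Local Open Scope ring_scope.

(** * Calculus of 2x2 integer matrices by their entries *)

Lemma mx2E (A : 'M[int]_2) : A = mx2 (A 0 0) (A 0 1) (A 1 0) (A 1 1).
Proof.
apply/matrixP => i j; rewrite mxE.
by move: i j => [[|[|//]] ?] [[|[|//]] ?] /=; congr (A _ _); apply: val_inj.
Qed.

Lemma mul_mx2 a b c d a' b' c' d' :
  mx2 a b c d *m mx2 a' b' c' d' =
  mx2 (a * a' + b * c') (a * b' + b * d') (c * a' + d * c') (c * b' + d * d').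
Proof.
by rewrite [LHS]mx2E !mxE !big_ord_recl !big_ord0 !mxE /= !addr0.
Qed.

Lemma opp_mx2 a b c d : - mx2 a b c d = mx2 (- a) (- b) (- c) (- d).
Proof. by rewrite [LHS]mx2E !mxE. Qed.

Lemma adj_mx2 a b c d : \adj (mx2 a b c d) = mx2 d (- b) (- c) a.
Proof.
rewrite [LHS]mx2E !mxE /cofactor !det_mx11 !mxE /=.
by congr mx2; rewrite /= ?expr0 ?expr1 /= ?mul1r ?mulN1r ?expr2 ?mulrNN ?mul1r.
Qed.

Lemma mx2_inj a b c d a' b' c' d' :
  mx2 a b c d = mx2 a' b' c' d' -> [/\ a = a', b = b', c = c' & d = d'].
Proof.
move=> E; split; [have := congr1 (fun A : 'M_2 => A 0 0) E
  |have := congr1 (fun A : 'M_2 => A 0 1) E|have := congr1 (fun A : 'M_2 => A 1 0) E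
  |have := congr1 (fun A : 'M_2 => A 1 1) E]; by rewrite !mxE.
Qed.

Lemma tr_mx2 a b c d : \tr (mx2 a b c d) = a + d.
Proof. by rewrite /mxtrace !big_ord_recl big_ord0 !mxE /= addr0. Qed.

Lemma mk2_subproof (a b c d : int) (h : a * d - b * c = 1) : \det (mx2 a b c d) == 1.
Proof. by rewrite det_mx2 h. Qed.

Definition mk2 (a b c d : int) (h : a * d - b * c = 1) : SL2Z := MkSL2 (mk2_subproof h).

Lemma sl2P (P : SL2Z -> Prop) :
  (forall (a b c d : int) (h : a * d - b * c = 1), P (mk2 h)) -> forall A, P A.
Proof.
move=> Pmk A; have := eqP (sl2_det A); rewrite {1}[sl2mx A]mx2E det_mx2 => h.
by have -> : A = mk2 h by apply: val_inj; rewrite /= -mx2E.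
Qed.

Lemma psl2P (P : PSL2Z -> Prop) :
  (forall (a b c d : int) (h : a * d - b * c = 1), P (psl (mk2 h))) -> forall X, P X.
Proof. by move=> Pmk; elim/pslP; elim/sl2P. Qed.

Lemma mul_psl A B : (psl A * psl B)%g = psl (sl2_mul A B).
Proof. exact: psl_mulE. Qed.

Lemma inv_psl A : ((psl A)^-1)%g = psl (sl2_inv A).
Proof. exact: psl_invE. Qed.

Lemma psl_eq A B : sl2mx A = sl2mx B -> psl A = psl B.
Proof. by move=> E; apply/psl_eqP; left. Qed.

Lemma psl_eqN A B : sl2mx A = - sl2mx B -> psl A = psl B.
Proof. by move=> E; apply/psl_eqP; right. Qed.

Lemma mx2_1 : 1%:M = mx2 1 0 0 1.
Proof. by rewrite [LHS]mx2E !mxE. Qed.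

(** * The mirror automorphism of PSL_2(Z) *)

Lemma sl2_flip_subproof (A : SL2Z) :
  \det (mx2 (sl2mx A 1 1) (sl2mx A 1 0) (sl2mx A 0 1) (sl2mx A 0 0)) == 1.
Proof.
elim/sl2P: A => a b c d h /=.
by rewrite det_mx2 !mxE /= -h; apply/eqP; ring.
Qed.

Definition sl2_flip (A : SL2Z) : SL2Z := MkSL2 (sl2_flip_subproof A).
Definition flip (X : PSL2Z) : PSL2Z := psl (sl2_flip (repr X)).

Lemma flip_psl A : flip (psl A) = psl (sl2_flip A).
Proof.
apply/psl_eqP => /=; case: (repr_psl A) => ->; [left|right]=> //.
by rewrite !mxE opp_mx2.
Qed.

Lemma flipM : {morph flip : X Y / (X * Y)%g}.
Proof.
elim/psl2P=> a b c d h; elim/psl2P=> a' b' c' d' h'.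
rewrite mul_psl !flip_psl mul_psl; apply: psl_eq => /=.
by rewrite mul_mx2 !mxE /= mul_mx2; congr mx2; ring.
Qed.

Lemma flipK : involutive flip.
Proof.
elim/psl2P=> a b c d h; rewrite !flip_psl; apply: psl_eq.
by rewrite /= !mxE.
Qed.

Lemma flip1 : flip 1%g = 1%g.
Proof. by apply: (mulgI (flip 1%g)); rewrite -flipM !mulg1. Qed.

Lemma flipV X : flip X^-1%g = (flip X)^-1%g.
Proof. by apply: (mulgI (flip X)); rewrite -flipM !mulgV flip1. Qed.

Lemma flipS : flip matS = matS.
Proof.
by rewrite flip_psl; apply: psl_eqN; rewrite /= opp_mx2 !mxE oppr0 opprK.
Qed.

Lemma flipR : flip matR = (matR * matR)%g.
Proof.
by rewrite flip_psl mul_psl; apply: psl_eqN; rewrite /= mul_mx2 opp_mx2 !mxE; congr mx2.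
Qed.

(** * The absolute trace, a conjugacy invariant *)

Definition abs_tr (X : PSL2Z) : int := `|\tr (sl2mx (repr X))|.

Lemma abs_tr_psl A : abs_tr (psl A) = `|\tr (sl2mx A)|.
Proof. by rewrite /abs_tr; case: (repr_psl A) => ->; rewrite ?raddfN ?normrN. Qed.

Lemma abs_trC X Y : abs_tr (X * Y)%g = abs_tr (Y * X)%g.
Proof.
by elim/pslP: X => A; elim/pslP: Y => B; rewrite !mul_psl !abs_tr_psl /= mxtrace_mulC.
Qed.

Lemma abs_trJ X U : abs_tr (X ^ U)%g = abs_tr X.
Proof. by rewrite conjgE abs_trC -mulgA mulgV mulg1. Qed.

Lemma abs_trV X : abs_tr X^-1%g = abs_tr X.
Proof.
elim/psl2P: X => a b c d h.
by rewrite inv_psl !abs_tr_psl /= adj_mx2 !tr_mx2 addrC.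
Qed.

Lemma abs_tr_flip X : abs_tr (flip X) = abs_tr X.
Proof.
elim/psl2P: X => a b c d h.
by rewrite flip_psl !abs_tr_psl /= !tr_mx2 !mxE addrC.
Qed.

(** * Generation of PSL_2(Z) by S and R *)

Lemma mulSS X : (X * matS * matS)%g = X.
Proof. exact: farey_swap2. Qed.

Lemma mulRRR X : (X * matR * matR * matR)%g = X.
Proof. exact: farey_rot3. Qed.

Lemma trans_subproof (z : int) : 1 * 1 - z * 0 = 1 :> int.
Proof. by rewrite mulr0 mulr1 subr0. Qed.

Definition trans (z : int) : PSL2Z := psl (mk2 (trans_subproof z)).

Lemma transD y z : trans (y + z) = (trans y * trans z)%g.
Proof. by rewrite mul_psl; apply: psl_eq; rewrite /= mul_mx2; congr mx2; ring. Qed.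

Lemma trans1 : trans 1 = (matR * matS)%g.
Proof. by rewrite mul_psl; apply: psl_eqN; rewrite /= mul_mx2 opp_mx2. Qed.

(* Euclid's algorithm on the bottom row. *)
Lemma PSL2Z_ind (P : PSL2Z -> Prop) : P 1%g ->
  (forall W, P W -> P (W * matS)%g) -> (forall W, P W -> P (W * matR)%g) ->
  forall W, P W.
Proof.
move=> P1 PS PR.
have PT z W : P W -> P (W * trans z)%g.
  have T0 : trans 0 = 1%g by apply: psl_eq; rewrite /= mx2_1.
  elim: z W => [|n IH|n IH] W PW; first by rewrite T0 mulg1.
    by rewrite -addn1 PoszD transD mulgA trans1 mulgA; apply/PS/PR/IH.
  have -> : - (n.+1%:Z) = - n%:Z + (- 1) by rewrite -addn1 PoszD opprD.
  rewrite transD mulgA.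
  have -> : trans (- 1) = (matS * matR * matR)%g.
    apply: (mulIg (trans 1)); rewrite -transD T0 trans1.
    by rewrite !mulgA mulRRR matS2.
  by rewrite !mulgA; apply/PR/PR/PS/IH.
suff PA n (a b c d : int) (h : a * d - b * c = 1) : (`|c| <= n)%N -> P (psl (mk2 h)).
  by elim/psl2P => a b c d h; apply: (PA `|c|%N).
elim: n a b c d h => [|n IH] a b c d h.
  rewrite leqn0 absz_eq0 => /eqP c0; move: h; rewrite c0 => h.
  have ad : a * d = 1 by rewrite -h; ring.
  have [a1|a1] : a = 1 \/ a = - 1.
    have : (a %| 1)%Z by apply/dvdzP; exists d; rewrite mulrC.
    by rewrite dvdz1 => /eqP; lia.
  - have d1 : d = 1 by rewrite -ad a1 mul1r.
    have -> : psl (mk2 h) = (1 * trans b)%g.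
      by rewrite mul1g; apply: psl_eq; rewrite /= a1 d1.
    exact: PT.
  have d1 : d = - 1 by rewrite -ad a1 mulN1r opprK.
  have -> : psl (mk2 h) = (1 * trans (- b))%g.
    by rewrite mul1g; apply: psl_eqN; rewrite /= a1 d1 opp_mx2 opprK.
  exact: PT.
move=> cn; have [c0|c0] := eqVneq c 0; first by apply: IH; rewrite c0.
have := ltz_mod d c0; have := modz_ge0 d c0; have := divz_eq d c.
move: (d %/ c)%Z (d %% c)%Z => q r dE r_ge0 r_lt.
(* Undoing [trans q] replaces d by its remainder r modulo c, and undoing S exchanges the columns up
   to sign, so the new lower left entry is r, with r < |c|. *)
have h' : (b - q * a) * (- c) - (- a) * r = 1 by rewrite -h dE; ring.
have -> : psl (mk2 h) = (psl (mk2 h') * matS * trans q)%g.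
  rewrite (mul_psl (mk2 h')) mul_psl; apply: psl_eqN.
  rewrite /= !mul_mx2 opp_mx2 dE.
  by congr mx2; ring.
by apply/PT/PS/IH; lia.
Qed.

(** * Words in RS and R^2 S, and hyperbolic elements *)

Definition turn (b : bool) : PSL2Z := if b then matR else (matR * matR)%g.

(** Each letter is a turn at a bullet vertex followed by the passage of a $\otimes$-vertex, so
    [W * word l] is the edge reached from W along the path with turns l. *)
Definition word (l : seq bool) : PSL2Z := (\prod_(b <- l) (turn b * matS))%g.

Lemma word_nil : word [::] = 1%g.
Proof. exact: big_nil. Qed.

Lemma word_cons b l : word (b :: l) = (turn b * matS * word l)%g.
Proof. exact: big_cons. Qed.

Lemma word_cat l l' : word (l ++ l') = (word l * word l')%g.
Proof. exact: big_cat. Qed.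

Lemma word_rcons l b : word (rcons l b) = (word l * turn b * matS)%g.
Proof. by rewrite -cats1 word_cat word_cons word_nil mulg1 mulgA. Qed.

(* Up to sign, RS and R^2 S are [[1, 1], [0, 1]] and [[1, 0], [1, 1]]. *)
Lemma word_mx l : exists a b c d, exists h : a * d - b * c = 1,
  [/\ word l = psl (mk2 h), 1 <= a, 0 <= b, 0 <= c & 1 <= d] /\
  (size l)%:Z <= b + c.
Proof.
elim/last_ind: l => [|l e [a [b [c [d [h [[El a1 b0 c0 d1] bc]]]]]]].
  exists 1, 0, 0, 1; have h : 1 * 1 - 0 * 0 = 1 :> int by [].
  by exists h; split=> //; split=> //; rewrite word_nil; apply: psl_eq; rewrite /= mx2_1.
rewrite word_rcons El size_rcons; case: e.
  (* Appending RS adds the first column to the second, so b + c grows by a >= 1; appending R^2 S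
     adds the second to the first, and b + c grows by d >= 1. *)
  have h' : a * (c + d) - (a + b) * c = 1 by rewrite -h; ring.
  exists a, (a + b), c, (c + d), h'; split; last by lia.
  split; [|lia..].
  by rewrite -mulgA -trans1 mul_psl; apply: psl_eq; rewrite /= mul_mx2; congr mx2; ring.
have h' : (a + b) * d - b * (c + d) = 1 by rewrite -h; ring.
exists (a + b), b, (c + d), d, h'; split; last by lia.
split; [|lia..].
rewrite /turn (mul_psl _ (MkSL2 matR_subproof)) !mul_psl.
by apply: psl_eqN; rewrite /= !mul_mx2 opp_mx2; congr mx2; ring.
Qed.

(** The bound on b + c leaves a nonzero entry off the diagonal. *)
Lemma word_neq1 l : l != [::] -> word l <> 1%g.
Proof.
case: l => // e l _.
have [a [b [c [d [h [[-> a1 b0 c0 d1] bc]]]]]] := word_mx (e :: l).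
by case/psl_eqP; rewrite /= mx2_1 ?opp_mx2 => /mx2_inj[]; move: bc => /=; lia.
Qed.

Lemma word_form g : exists a b l,
  g = ((if a then matS else 1) * word l * (if b then matS else 1))%g.
Proof.
elim/PSL2Z_ind: g => [|W [a [b [l ->]]]|W [a [b [l ->]]]].
- by exists false, false, [::]; rewrite word_nil !mulg1.
- by exists a, (~~ b), l; case: b => /=; rewrite ?mulSS ?mulg1.
case: b; last first.
  by exists a, true, (rcons l true); rewrite word_rcons mulg1 !mulgA mulSS.
(* The outer S cancels the S of the last letter, so the new R meets the turn e at the same vertex:
   it gives R^2 or cancels. For an empty word, the two outer powers of S combine instead. *)
case/lastP: l => [|l e].
  exists (~~ a), true, [:: true]; rewrite word_cons word_nil !mulg1.
  by rewrite !mulgA mulSS; case: a; rewrite /= ?mul1g ?matS2 ?mul1g.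
rewrite word_rcons !mulgA mulSS; case: e => /=.
  by exists a, true, (rcons l false); rewrite word_rcons !mulgA mulSS.
by exists a, false, l; rewrite mulg1 !mulgA mulRRR.
Qed.

Lemma abs_trS : abs_tr matS = 0.
Proof. by rewrite abs_tr_psl /= tr_mx2. Qed.

Lemma abs_tr_turn b : abs_tr (turn b) = 1.
Proof.
have tR : abs_tr matR = 1 by rewrite abs_tr_psl /= tr_mx2.
by case: b => //=; rewrite -flipR abs_tr_flip.
Qed.

Lemma turn_mul b c :
  (turn b * turn c)%g = 1%g \/ exists d, (turn b * turn c)%g = turn d.
Proof.
case: b; case: c => /=; rewrite ?mulgA ?matR3; try by left.
  by right; exists false.
by right; exists true; rewrite mul1g.
Qed.

Definition word_conj (g : PSL2Z) : Prop :=
  exists U l, l != [::] /\ (g ^ U)%g = word l.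

Lemma word_conjJ g U : word_conj (g ^ U)%g -> word_conj g.
Proof. by case=> V [l [l0 E]]; exists (U * V)%g, l; rewrite conjgM. Qed.

Lemma word_conjM g h : word_conj (g * h)%g -> word_conj (h * g)%g.
Proof. by move=> gh; apply: (@word_conjJ _ h); rewrite conjgE -mulgA mulKg. Qed.

Lemma word_conj_word l : 2 < abs_tr (word l) -> word_conj (word l).
Proof.
move=> tr; exists 1%g, l; rewrite conjg1; split=> //.
by apply/eqP => l0; move: tr; rewrite l0 word_nil abs_tr_psl /= mx2_1 tr_mx2.
Qed.

(** The final S cancels that of the last letter, and conjugation brings the remaining turn to the
    front, next to the first turn. Either the two cancel and a shorter instance is left, or they
    merge into one turn and a word is left. Reduction to S or to a single turn is excluded by their
    traces 0 and 1. *)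
Lemma word_conj_wordS l :
  2 < abs_tr (word l * matS)%g -> word_conj (word l * matS)%g.
Proof.
have [n] := ubnP (size l); elim: n => // n IH in l *.
case/lastP: l => [|l b]; first by rewrite word_nil mul1g abs_trS.
rewrite word_rcons mulSS size_rcons ltnS; case: l => [|c l] /= ln.
  by rewrite word_nil mul1g abs_tr_turn.
rewrite abs_trC => tr; apply: word_conjM; move: tr.
rewrite word_cons !mulgA; case: (turn_mul b c) => [->|[d ->]].
  by rewrite mul1g abs_trC => tr; apply/word_conjM/IH => //; lia.
by rewrite -word_cons; apply: word_conj_word.
Qed.

(** Conjugation moves the outer S on the left to the end, where it cancels the other one or stays
    alone. *)
Lemma hyperbolic_word_conj M : hyperbolic M -> word_conj M.
Proof.
rewrite /hyperbolic -/(abs_tr M); have [a [b [l ->]]] := word_form M.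
rewrite -mulgA abs_trC => tr; apply: word_conjM; move: tr.
case: a; case: b; rewrite ?mulg1 ?mulSS; try exact: word_conj_word;
  exact: word_conj_wordS.
Qed.

(** A conjugate of M^n is the n-fold repetition of a nonempty word. *)
Lemma hyperbolic_expn_neq1 M n : hyperbolic M -> (0 < n)%N -> (M ^+ n)%g <> 1%g.
Proof.
move=> /hyperbolic_word_conj[U [l [l0 MU]]] n_gt0 Mn1.
have wn k : word (flatten (nseq k l)) = (word l ^+ k)%g.
  by elim: k => [|k IH] /=; rewrite ?word_nil ?expg0 // word_cat IH expgS.
apply: (@word_neq1 (flatten (nseq n l))).
  by case: n n_gt0 {Mn1} => //= n _; case: l l0 {MU wn}.
by rewrite wn -MU -conjXg Mn1 conj1g.
Qed.

(** * The form of a hyperbolic element *)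

Definition sl2_coefs (A : SL2Z) : form :=
  Form (sl2mx A 1 0) (sl2mx A 1 1 - sl2mx A 0 0) (- sl2mx A 0 1).

Definition content (f : form) : int := gcdz (coefC f) (gcdz (coefB f) (coefA f)).

Definition scale_form (k : int) (f : form) : form :=
  Form (k * coefA f) (k * coefB f) (k * coefC f).

Lemma scale_formI k f g : k != 0 -> scale_form k f = scale_form k g -> f = g.
Proof.
case: f g => a b c [a' b' c'] /mulfI k0 [].
by move=> /k0-> /k0-> /k0->.
Qed.

Definition discr (f : form) : int := coefB f ^+ 2 - 4 * coefA f * coefC f.

Lemma discr_scale k f : discr (scale_form k f) = k ^+ 2 * discr f.
Proof. by rewrite /discr /=; ring. Qed.

Lemma discr_sl2_coefs A : discr (sl2_coefs A) = \tr (sl2mx A) ^+ 2 - 4.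
Proof.
elim/sl2P: A => p q r s h; rewrite /discr /= tr_mx2 !mxE /=.
transitivity ((p + s) ^+ 2 - 4 * (p * s - q * r)); first by ring.
by rewrite h mulr1.
Qed.

Lemma sl2_coefs_inj A B :
  \tr (sl2mx A) = \tr (sl2mx B) -> sl2_coefs A = sl2_coefs B -> A = B.
Proof.
elim/sl2P: A => p q r s h; elim/sl2P: B => p' q' r' s' h'.
rewrite /= !tr_mx2 /sl2_coefs /= !mxE /= => tr [rr sp qq].
by apply: val_inj; rewrite /= rr; congr mx2; lia.
Qed.

Lemma sl2_act_scale U k f :
  sl2_act U (scale_form k f) = scale_form k (sl2_act U f).
Proof. by rewrite /sl2_act /scale_form /form_eval /=; congr Form; ring. Qed.

(** A division-free description of f_M: identities can be proved for [sl2_coefs], whose entries are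
    linear in the matrix, and the content cancelled afterwards. *)
Lemma sl2_formE A :
  scale_form (content (sl2_coefs A)) (sl2_form A) =
  scale_form (sgz (\tr (sl2mx A))) (sl2_coefs A).
Proof.
elim/sl2P: A => p q r s h; rewrite /= tr_mx2 /content /sl2_form /scale_form /= !mxE /=.
rewrite gcdNz; set d := gcdz q _.
have dq : (d %| - q)%Z by rewrite dvdzE abszN -dvdzE dvdz_gcdl.
have ds : (d %| s - p)%Z by apply: dvdz_trans (dvdz_gcdr _ _) (dvdz_gcdl _ _).
have dr : (d %| r)%Z by apply: dvdz_trans (dvdz_gcdr _ _) (dvdz_gcdr _ _).
by congr Form; rewrite mulrCA; congr (_ * _); rewrite mulrC divzK.
Qed.

Lemma sl2_coefsJ U A :
  sl2_coefs (sl2_mul (sl2_inv U) (sl2_mul A U)) = sl2_act U (sl2_coefs A).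
Proof.
elim/sl2P: U => a b c d h; elim/sl2P: A => p q r s h'.
rewrite /sl2_coefs /sl2_act /form_eval /= adj_mx2 !mul_mx2 !mxE /=.
by congr Form; ring.
Qed.

Lemma dvdz_content d f :
  (d %| content f)%Z = [&& (d %| coefA f), (d %| coefB f) & (d %| coefC f)]%Z.
Proof. by rewrite /content !dvdz_gcd andbC [(_ %| coefB _)%Z && _]andbC -andbA. Qed.

Lemma content_act_dvd U f : (content f %| content (sl2_act U f))%Z.
Proof.
have := dvdzz (content f); rewrite !dvdz_content => /and3P[].
move: (content f) => k; case: f => A B C /= /dvdzP[a ->] /dvdzP[b ->] /dvdzP[c ->].
rewrite /sl2_act /form_eval; elim/sl2P: U => x y z t h /=; rewrite !mxE /=.
by apply/and3P; split; [ apply/dvdzP; exists (a * x ^+ 2 + b * x * z + c * z ^+ 2)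
  | apply/dvdzP; exists (2 * a * x * y + b * (x * t + y * z) + 2 * c * z * t)
  | apply/dvdzP; exists (a * y ^+ 2 + b * y * t + c * t ^+ 2)]; ring.
Qed.

Lemma sl2_actM U V f : sl2_act V (sl2_act U f) = sl2_act (sl2_mul U V) f.
Proof.
elim/sl2P: U => a b c d h; elim/sl2P: V => x y z t h'.
by rewrite /sl2_act /form_eval /= mul_mx2 !mxE /=; congr Form; ring.
Qed.

Lemma sl2_act1 f : sl2_act sl2_one f = f.
Proof.
by case: f => a b c; rewrite /sl2_act /form_eval /= mx2_1 !mxE /=; congr Form; ring.
Qed.

(** Each content divides the other, the converse divisibility coming from U^-1. *)
Lemma content_act U f : content (sl2_act U f) = content f.
Proof.
apply/eqP; rewrite -[_ == _]/(Posz _ == Posz _) eqz_nat eqn_dvd.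
apply/andP; split; last exact: content_act_dvd.
have := content_act_dvd (sl2_inv U) (sl2_act U f).
by rewrite sl2_actM sl2_mulVr sl2_act1.
Qed.

(** Zero content means a scalar matrix; determinant 1 then forces the trace to be 2 or -2. *)
Lemma content_neq0 A : 2 < `|\tr (sl2mx A)| -> content (sl2_coefs A) != 0.
Proof.
elim/sl2P: A => p q r s h; rewrite /= tr_mx2 => tr; apply/negP => /eqP c0.
have := dvdzz (content (sl2_coefs (mk2 h))); rewrite dvdz_content c0 /= !dvd0z !mxE /=.
case/and3P=> /eqP r0 /eqP sp /eqP q0; have E : s = p by lia.
move: {c0} h tr; rewrite E r0 mulr0 subr0 => h.
have : (p %| 1)%Z by apply/dvdzP; exists p.
by rewrite dvdz1 => /eqP; lia.
Qed.

(** Content and trace are invariant under conjugation, so the equivariance of [sl2_coefs] passes to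
    the primitive form. *)
Lemma form_of_conj U M :
  hyperbolic M -> form_act U (form_of M) = form_of (M ^ U)%g.
Proof.
elim/pslP: U => U; elim/pslP: M => A /hyperbolic_psl hA.
rewrite conjgE (mul_psl A U) inv_psl mul_psl !form_of_psl form_act_psl.
set B := sl2_mul _ _.
have cB : content (sl2_coefs B) = content (sl2_coefs A).
  by rewrite /B sl2_coefsJ content_act.
apply: (scale_formI (content_neq0 hA)).
rewrite -[in RHS]cB sl2_formE -sl2_act_scale sl2_formE sl2_act_scale -sl2_coefsJ.
congr (scale_form (sgz _) _).
by rewrite /B /= mulmxA mxtrace_mulC mulmxA mul_mx_adj (eqP (sl2_det U)) mul1mx.
Qed.

(** The element on the right is M with its diagonal entries exchanged, which only changes the sign
    of s - p. *)
Lemma form_inv_of M : form_inv (form_of M) = form_of (((flip M)^-1) ^ matS)%g.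
Proof.
elim/psl2P: M => p q r s h.
rewrite flip_psl inv_psl.
have h' : s * p - q * r = 1 by rewrite -h; ring.
have -> : (psl (sl2_inv (sl2_flip (mk2 h))) ^ matS)%g = psl (mk2 h').
  apply: (mulgI matS); rewrite -conjgC (mul_psl (sl2_inv _)) mul_psl.
  by apply: psl_eq; rewrite /= !adj_mx2 !mul_mx2 !mxE /=; congr mx2; ring.
rewrite !form_of_psl /sl2_form /form_inv /= !mxE /= -(opprB p s) gcdNz.
rewrite (divNz (m := p - s)); last exact: dvdz_trans (dvdz_gcdr _ _) (dvdz_gcdl _ _).
by rewrite (addrC s p) mulrN opprK.
Qed.

(** For representatives of positive trace t the sign factor is 1. As t^2 - 4 is the squared content
    times the discriminant of the common form, the contents agree; the unreduced form and the trace
    then give all four entries. *)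
Lemma form_of_inj M N : hyperbolic M -> abs_tr N = abs_tr M ->
  form_of M = form_of N -> M = N.
Proof.
have pos X : hyperbolic X -> exists2 A, X = psl A & 2 < \tr (sl2mx A).
  elim/psl2P: X => a b c d h /hyperbolic_psl; rewrite /= tr_mx2 => tr.
  have h' : (- a) * (- d) - (- b) * (- c) = 1 by rewrite -h; ring.
  have [ad|ad] := lerP 0 (a + d).
    by exists (mk2 h); rewrite //= tr_mx2 -(ger0_norm ad).
  exists (mk2 h'); first by apply: psl_eqN; rewrite /= opp_mx2 !opprK.
  by rewrite /= tr_mx2 -opprD -(ltr0_norm ad).
move=> hM tr; have hN : hyperbolic N by rewrite /hyperbolic -/(abs_tr N) tr.
have [A EA tA] := pos _ hM; have [B EB tB] := pos _ hN.
move: tr hM hN; rewrite EA EB !abs_tr_psl !form_of_psl.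
rewrite !gtr0_norm; try by apply: lt_trans tA || apply: lt_trans tB.
move=> tr /hyperbolic_psl/content_neq0 cA /hyperbolic_psl/content_neq0 cB fAB.
have sg1 x : 2 < x -> sgz x = 1 by move=> x2; apply: gtr0_sgz; apply: lt_trans x2.
have := sl2_formE A; have := sl2_formE B; rewrite -fAB !sg1 // => eB eA.
have cAB : content (sl2_coefs A) = content (sl2_coefs B).
  have dA := congr1 discr eA; have dB := congr1 discr eB; move: dA dB.
  rewrite !discr_scale !discr_sl2_coefs expr1n !mul1r tr => <- E.
  have D0 : discr (sl2_form A) != 0.
    apply/eqP => D0; move: E (congr1 discr eA); rewrite !discr_scale D0 mulr0 => _.
    by rewrite discr_sl2_coefs; nia.
  by move/(mulIf D0): E => /eqP; rewrite eqrXn2 // => /eqP.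
have inj1 f g : scale_form 1 f = scale_form 1 g -> f = g by apply: scale_formI.
by rewrite (@sl2_coefs_inj A B) //; apply: inj1; rewrite -eA -eB cAB.
Qed.

(** * Paths in the Farey tree and the direction of the axis *)

Lemma matS_neq1 : matS <> 1%g.
Proof. by move=> S1; have := abs_trS; rewrite S1 abs_tr_psl /= mx2_1 tr_mx2. Qed.

Lemma turn_neq1 b : turn b <> 1%g.
Proof.
by move=> b1; have := abs_tr_turn b; rewrite b1 abs_tr_psl /= mx2_1 tr_mx2.
Qed.

Lemma mulg_neq (W X : PSL2Z) : X <> 1%g -> (W * X)%g <> W.
Proof. by move=> X1; rewrite -[RHS]mulg1 => /mulgI. Qed.

Lemma step_bullet (W : PSL2Z) (d : dart farey) :
  step (G := farey) (W, true) d <-> exists b, d = ((W * turn b)%g, false).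
Proof.
case: d => e c; split=> [[/= -> eW]|[b [-> ->]]].
  by case=> // ->; [exists true|exists false]; rewrite //= mulgA.
split=> //=; first exact/mulg_neq/turn_neq1.
by case: b; [constructor 2|constructor 3; rewrite /= mulgA].
Qed.

Lemma step_otimes (W : PSL2Z) (d : dart farey) :
  step (G := farey) (W, false) d <-> d = ((W * matS)%g, true).
Proof.
case: d => e c; split=> [[/= -> eW]|[-> ->]].
  by case=> // ->.
by split=> //=; [exact/mulg_neq/matS_neq1|right].
Qed.

Lemma step_rev (G : ribbon) (e e' : edge G) b b' :
  step (e, b) (e', b') -> step (e', ~~ b') (e, ~~ b).
Proof.
case=> /= -> ne; case: b => /= h; split=> //=; try by move=> E; apply: ne.
  by case: h => -> //; [constructor 1|constructor 3|constructor 2]; rewrite ?rot3.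
by case: h => ->; [left|right; rewrite swap2].
Qed.

Lemma on_axis_rev M W b : on_axis M (W, b) -> on_axis M^-1%g (W, ~~ b).
Proof.
case=> path [k [k_gt0 pstep pM p0]].
exists (fun n => ((path (- n)).1, ~~ (path (- n)).2)), k; split=> //.
- move=> n; have := pstep (- (n + 1)); rewrite opprD subrK.
  by case: (path _) => e c; case: (path _) => e' c'; exact: step_rev.
- move=> n /=; have := pM (- (n + k%:Z)); rewrite opprD subrK => ->.
  by rewrite /= mulKg.
- by rewrite oppr0 p0.
Qed.

Lemma on_axis_mul M d : on_axis M d -> on_axis M ((M * d.1)%g, d.2).
Proof.
case=> path [k [k_gt0 pstep pM p0]].
exists (fun n => path (n + k%:Z)), k; split=> //.
- by move=> n; rewrite [n + 1 + _]addrAC.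
- by rewrite pM p0.
Qed.

(** As [flip] fixes S and exchanges R and R^2, it preserves paths without backtracking; the
    hypothesis turns the translation by M into that by N. *)
Lemma on_axis_flip M N U d :
  (U * flip M)%g = (N * U)%g ->
  on_axis M d -> on_axis N ((U * flip d.1)%g, d.2).
Proof.
move=> UMN [path [k [k_gt0 pstep pM p0]]].
exists (fun n => ((U * flip (path n).1)%g, (path n).2)), k; split=> //.
- move=> n; have := pstep n; case: (path n) => e b; case: (path (n + 1)) => e' b'.
  case: b; last first.
    move/step_otimes => [-> ->]; apply/step_otimes.
    by rewrite /= flipM flipS mulgA.
  move/step_bullet => [c [-> ->]]; apply/step_bullet; exists (~~ c).
  rewrite /= flipM mulgA; congr (_ * _, _)%g.
  case: c; rewrite /= ?flipM flipR //.
  by rewrite !mulgA matR3 mul1g.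
- by move=> n; rewrite pM /= flipM !mulgA UMN.
- by rewrite p0.
Qed.

Lemma on_axis_word M W :
  on_axis M (W, true) -> exists2 l, l != [::] & (M * W)%g = (W * word l)%g.
Proof.
case=> path [k [k_gt0 pstep pM p0]].
have even n : exists2 l, size l = n & path (n.*2)%:Z = ((W * word l)%g, true).
  elim: n => [|n [l sl pn]]; first by exists [::]; rewrite // word_nil mulg1.
  have := pstep (n.*2)%:Z; rewrite pn => /step_bullet[b pn1].
  have := pstep ((n.*2)%:Z + 1); rewrite pn1 => /step_otimes pn2.
  exists (rcons l b); first by rewrite size_rcons sl.
  by rewrite word_rcons !mulgA -pn2; congr path; lia.
have pk := pM 0; rewrite add0r p0 /= in pk.
have [l sl pl] := even k./2.
(* An odd period is impossible: darts alternate between the two kinds along the path, while M keeps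
   the kind. *)
have := odd_double_half k; case: (odd k) => [k1|]; last first.
  rewrite add0n => kE; move: pk; rewrite -{1}kE pl => -[EW]; exists l => //.
  by apply: contraTneq k_gt0 => l0; rewrite -kE -sl l0.
have := pstep (k./2.*2)%:Z; rewrite pl => /step_bullet[b].
have -> : k./2.*2%:Z + 1 = k%:Z by lia.
by rewrite pk.
Qed.

(** Otherwise M and M^-1 both move W along nonempty words, and the concatenation of these words is
    trivial. *)
Lemma on_axis_not_rev M W b : on_axis M (W, b) -> ~ on_axis M (W, ~~ b).
Proof.
wlog: b / b.
  by case: b => [|H aF aT]; [exact|exact: (H true)].
case: b => // _ /on_axis_word[l l0 El] /on_axis_rev/on_axis_word[l' _ El'].
have := @word_neq1 (l' ++ l); case; first by case: l' {El'}.
by apply: (mulgI W); rewrite word_cat mulgA -El' -mulgA -El mulKg mulg1.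
Qed.

(** * Existence of the axis *)

Definition zexpg (X : PSL2Z) (z : int) : PSL2Z :=
  match z with Posz n => (X ^+ n)%g | Negz n => (X ^- n.+1)%g end.

Lemma zexpgS X z : zexpg X (z + 1) = (X * zexpg X z)%g.
Proof.
case: z => n; first by rewrite -PoszD addn1 /= expgS.
have -> : Negz n + 1 = - n%:Z by lia.
case: n => [|n] /=; first by rewrite expg1 mulgV.
by rewrite [in RHS]expgSr invgM mulVKg.
Qed.

Lemma zexpgSr X z : zexpg X (z + 1) = (zexpg X z * X)%g.
Proof.
case: z => n; first by rewrite -PoszD addn1 /= expgSr.
have -> : Negz n + 1 = - n%:Z by lia.
case: n => [|n] /=; first by rewrite expg1 mulVg.
by rewrite [in RHS]expgS invgM mulgVK.
Qed.

Lemma word_on_axis M W l :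
  l != [::] -> (M * W)%g = (W * word l)%g -> on_axis M (W, true).
Proof.
move=> l0 MW; pose N := size l; have N_gt0 : (0 < N)%N by rewrite lt0n size_eq0.
(* The turns of l are repeated periodically: for j = qN + i with 0 <= i < N, the first i letters are
   followed from M^q W. *)
pose g (j : int) := (zexpg M (j %/ N)%Z * W * word (take `|j %% N|%Z%N l))%g.
(* The value i = N is included: there the relation between M, W and l identifies the end of a period
   with the start of the next. *)
have gE (q : int) (i : nat) : (i <= N)%N ->
    g (q * N%:Z + i%:Z) = (zexpg M q * W * word (take i l))%g.
  rewrite leq_eqVlt => /orP[/eqP->|iN].
    have -> : q * N%:Z + N%:Z = (q + 1) * N%:Z by ring.
    rewrite /g mulzK ?modzMl; last by lia.
    by rewrite take0 word_nil take_size zexpgSr mulg1 -!mulgA MW.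
  by rewrite /g divzMDl ?divz_small ?modzMDl ?modz_small ?addr0 ?absz_nat //; lia.
have gdec j : exists (q : int) (i : nat), (i < N)%N /\ j = q * N%:Z + i%:Z.
  exists (j %/ N)%Z, `|j %% N|%Z%N; have := divz_eq j N.
  have := @modz_ge0 j N; have := @ltz_mod j N; lia.
have gS j : exists b, g (j + 1) = (g j * turn b * matS)%g.
  have [q [i [iN ->]]] := gdec j; exists (nth true l i).
  rewrite -addrA -PoszD addn1 !gE //; last exact: ltnW.
  by rewrite (take_nth true) // word_rcons !mulgA.
have gN j : g (j + N%:Z) = (M * g j)%g.
  have [q [i [iN ->]]] := gdec j.
  have -> : q * N%:Z + i%:Z + N%:Z = (q + 1) * N%:Z + i%:Z by ring.
  by rewrite !gE 1?ltnW // zexpgS !mulgA.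
clearbody g.
(* Every letter takes two darts, so the period is 2N; the odd dart runs back along the edge
   preceding [g (j + 1)], that is, before its final S. *)
pose path (n : int) : dart farey :=
  if (n %% 2)%Z == 0 then (g (n %/ 2)%Z, true)
  else ((g ((n %/ 2)%Z + 1) * matS)%g, false).
exists path, N.*2; split.
- by rewrite double_gt0.
- move=> n; rewrite /path; have [n0|n1] := eqVneq (n %% 2)%Z 0.
    have -> : ((n + 1) %% 2)%Z = 1 by lia.
    have -> : ((n + 1) %/ 2)%Z = (n %/ 2)%Z by lia.
    apply/step_bullet => /=; have [b ->] := gS (n %/ 2)%Z; exists b.
    by rewrite mulSS.
  have -> : ((n + 1) %% 2)%Z = 0 by lia.
  have -> : ((n + 1) %/ 2)%Z = (n %/ 2)%Z + 1 by lia.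
  by apply/step_otimes; rewrite mulSS.
- move=> n; rewrite /path.
  have -> : ((n + N.*2%:Z) %% 2)%Z = (n %% 2)%Z by lia.
  have -> : ((n + N.*2%:Z) %/ 2)%Z = (n %/ 2)%Z + N%:Z by lia.
  by rewrite [_ + N%:Z + 1]addrAC !gN; case: ifP => _ //=; rewrite mulgA.
- rewrite /path /= -[(0 %/ 2)%Z]/(0 * N%:Z + 0%:Z).
  by rewrite gE // take0 word_nil mulg1 mul1g.
Qed.

Lemma axis_exists M : hyperbolic M -> exists W, on_axis M (W, true).
Proof.
move=> /hyperbolic_word_conj[W [l [l0 E]]]; exists W.
by apply: (word_on_axis l0); rewrite -E -conjgC.
Qed.

Lemma on_axis_cyclic M X W b :
  cyclic_subgroup M X -> on_axis M (W, b) -> on_axis M ((X * W)%g, b).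
Proof.
have pow N n V c : on_axis N (V, c) -> on_axis N ((N ^+ n * V)%g, c).
  elim: n => [|n IH] aV; first by rewrite mul1g.
  by rewrite expgS -mulgA; apply: (on_axis_mul (IH aV)).
case=> n [->|->]; first exact: pow.
by move=> /on_axis_rev/pow => /(_ n)/on_axis_rev; rewrite invgK negbK expVgn.
Qed.

(** The axis is stable under <M>, so the choice of lift in the definition of the spine is
    immaterial. *)
Lemma spine_cark M W b :
  @spine (cark_of M) (proj M W, b) <-> on_axis M (W, b).
Proof.
split=> [[V [/projP[X MX ->] aV]]|aW]; last by exists W.
exact: on_axis_cyclic aV.
Qed.

Lemma proj_surj M (x : orbit_edge M) : exists W, proj M W = x.
Proof. by exists (repr x); rewrite /proj reprK. Qed.

(** * Ambiguous çarks and conjugation of [flip M] to M^-1 *)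

Lemma flip_cyclic M N U X : (U * flip M)%g = (N * U)%g ->
  cyclic_subgroup M X -> exists2 Y, cyclic_subgroup N Y & (U * flip X)%g = (Y * U)%g.
Proof.
move=> UMN.
have pow n : (U * flip (M ^+ n))%g = (N ^+ n * U)%g.
  elim: n => [|n IH]; first by rewrite flip1 mulg1 mul1g.
  by rewrite !expgS flipM mulgA UMN -mulgA IH mulgA.
case=> n [->|->]; first by exists (N ^+ n)%g; [exists n; left|].
exists (N ^- n)%g; first by exists n; right.
by apply: (mulgI (N ^+ n)%g); rewrite mulgA -pow flipV mulgK mulVKg.
Qed.

Lemma cyclic_inv M X : cyclic_subgroup M^-1%g X -> cyclic_subgroup M X.
Proof. by case=> n [->|->]; exists n; [right|left]; rewrite expVgn ?invgK. Qed.

Lemma ambiguous_cark_flip M U :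
  (U * flip M)%g = (M^-1 * U)%g -> ambiguous_cark (cark_of M).
Proof.
move=> UM; pose phi V (x : orbit_edge M) := proj M (V * flip (repr x))%g.
have phiE V W : (V * flip M)%g = (M^-1 * V)%g ->
    phi V (proj M W) = proj M (V * flip W)%g.
  move=> VM; have /projP[X MX EX] : proj M (repr (proj M W)) = proj M W.
    by rewrite /proj reprK.
  have [Y MY EY] := flip_cyclic VM MX.
  apply/projP; exists Y; first exact: cyclic_inv.
  by rewrite {1}EX flipM mulgA EY mulgA.
(* The inverse of W |-> U flip(W) is W |-> flip(U^-1) flip(W), a map of the same shape. *)
have UM' : (flip U^-1 * flip M)%g = (M^-1 * flip U^-1)%g.
  apply: (can_inj flipK); rewrite !flipM !flipK flipV.
  apply: (mulIg U); rewrite mulgVK; apply: (mulgI U).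
  rewrite !mulgA mulgV mul1g; apply: (mulIg (flip M)).
  by rewrite mulgVK -mulgA UM mulVKg.
exists (phi U); split.
- exists (phi (flip U^-1)%g) => x; have [W <-] := proj_surj x; rewrite !phiE //.
    by rewrite flipM flipK flipV mulgA mulVg mul1g.
  by rewrite flipM !flipK mulVKg.
- move=> x; have [W <-] := proj_surj x; rewrite /= orbit_swapE !phiE // orbit_swapE /=.
  by rewrite flipM flipS mulgA.
- move=> x; have [W <-] := proj_surj x; rewrite /= orbit_rotE !phiE // !orbit_rotE /=.
  by rewrite flipM flipR !mulgA.
(* The axis of M goes to that of M^-1, which is the axis of M with all darts reversed, as the spine
   of the mirror image requires. *)
- move=> x b; have [W <-] := proj_surj x; rewrite phiE //.
  split=> [/(spine_cark M W b) aW|/(spine_cark M _ (~~ b)) aW].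
    apply/(spine_cark M _ (~~ b)).
    by move/(on_axis_flip UM)/on_axis_rev: aW; rewrite invgK.
  apply/(spine_cark M W b); move/(on_axis_flip UM')/on_axis_rev: aW.
  by rewrite /= flipM flipK flipV mulgA mulVg mul1g invgK negbK.
Qed.

(** M has infinite order, so two exponents expressing M and X through each other have product 1. *)
Lemma hyperbolic_cyclic_eq M X : hyperbolic M ->
  cyclic_subgroup M X -> cyclic_subgroup X M -> X = M \/ X = M^-1%g.
Proof.
move=> hM; have hV : hyperbolic M^-1%g by rewrite /hyperbolic -/(abs_tr _) abs_trV.
have expn_eq Z k : hyperbolic Z -> (Z ^+ k = Z)%g -> k = 1.
  move=> hZ; case: k => [|[|k]] // E.
    by case: (@hyperbolic_expn_neq1 Z 1) => //; rewrite expg1 -E.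
  case: (@hyperbolic_expn_neq1 Z k.+1) => //.
  by apply: (mulgI Z); rewrite -expgS E mulg1.
have expn_neqV Z k : hyperbolic Z -> (Z ^+ k)%g <> Z^-1%g.
  move=> hZ E; case: (@hyperbolic_expn_neq1 Z k.+1) => //.
  by rewrite expgS E mulgV.
case=> n [->|->] [m [E|E]].
- left; move: E; rewrite -expgnA => /esym/expn_eq-/(_ hM)/eqP.
  by rewrite muln_eq1 => /andP[/eqP->].
- by case: (expn_neqV M (n * m)%N) => //; rewrite expgnA {2}E invgK.
- case: (expn_neqV M^-1%g (n * m)%N) => //.
  by rewrite invgK [RHS]E expgnA !expVgn.
- right; have : (M^-1 ^+ (n * m) = M^-1)%g by rewrite {2}E invgK expgnA !expVgn.
  move/expn_eq=> /(_ hV)/eqP.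
  by rewrite muln_eq1 => /andP[/eqP->].
Qed.

Lemma ambiguous_cark_conj M : hyperbolic M -> ambiguous_cark (cark_of M) ->
  exists U, (U * flip M)%g = (M^-1 * U)%g.
Proof.
move=> hM [phi [/bij_inj phi_inj phi_swap phi_rot phi_spine]].
have [U phi1] : exists U, phi (proj M 1%g) = proj M U.
  by have [U <-] := proj_surj (phi (proj M 1%g)); exists U.
(* An isomorphism is determined by the image of one edge; in the mirror image [rot] is right
   multiplication by R^2, the flip of R. *)
have phiE W : phi (proj M W) = proj M (U * flip W)%g.
  elim/PSL2Z_ind: W => [|W IH|W IH]; first by rewrite flip1 mulg1.
    have := phi_swap (proj M W); rewrite /= orbit_swapE => ->.
    by rewrite IH orbit_swapE flipM flipS mulgA.
  have := phi_rot (proj M W); rewrite /= orbit_rotE => ->.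
  by rewrite IH !orbit_rotE flipM flipR !mulgA.
have MM : cyclic_subgroup M M by exists 1; left; rewrite expg1.
(* That phi is well defined on the coset of 1 gives X in <M> with U flip(M) = X U. *)
have : phi (proj M 1%g) = phi (proj M M).
  by congr phi; apply/projP; exists M; rewrite ?mulg1.
rewrite phi1 phiE => /projP[X MX EX].
(* This edge is sent to the coset of M U, which is that of U; injectivity puts it in <M>, and hence
   M in <X>. *)
have : phi (proj M 1%g) = phi (proj M (flip (U^-1 * M * U)))%g.
  rewrite phi1 phiE flipK; apply/projP; exists M => //.
  by rewrite !mulgA mulgV mul1g.
move=> /phi_inj/projP[Y MY]; rewrite mulg1 => EY.
have XM : cyclic_subgroup X M.
  have [Z XZ EZ] := flip_cyclic EX MY.
  suff -> : M = Z by [].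
  by apply: (mulIg U); rewrite -EZ -EY flipK !mulgA mulgV mul1g.
exists U; rewrite EX; congr (_ * _)%g.
case: (hyperbolic_cyclic_eq hM MX XM) => // XE.
(* If X = M, the map preserves the directed axis, whereas the spine of the mirror image has the
   reversed darts. *)
have [W aW] := axis_exists hM; rewrite XE in EX.
case: (on_axis_not_rev (on_axis_flip EX aW)) => /=.
apply/(spine_cark M _ false); rewrite -phiE.
exact: (proj1 (phi_spine _ true) (proj2 (spine_cark M W true) aW)).
Qed.

(** * Ambiguous forms, and the equivalence *)

Lemma hyperbolicJ M U : hyperbolic M -> hyperbolic (M ^ U)%g.
Proof. by rewrite /hyperbolic -!/(abs_tr _) abs_trJ. Qed.

Lemma conj_flipE M U :
  (U * flip M)%g = (M^-1 * U)%g <-> (M ^ U)%g = (flip M)^-1%g.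
Proof.
split=> [E|E]; last by rewrite -[flip M]invgK -E -conjVg -conjgC.
apply: (mulgI U); rewrite -conjgC; apply: (mulIg (flip M)).
by rewrite mulgVK -mulgA E mulVKg.
Qed.

Lemma ambiguous_form_conj M : hyperbolic M ->
  ambiguous_form (form_of M) <-> exists U, (U * flip M)%g = (M^-1 * U)%g.
Proof.
move=> hM; rewrite /ambiguous_form /form_equiv form_inv_of.
split=> [[U E]|[U /conj_flipE E]].
  (* The factor S^-1 undoes the conjugation by S in [form_inv_of]. *)
  exists (U * matS^-1)%g; apply/conj_flipE; rewrite conjgM.
  move: E; rewrite form_of_conj // => /esym/form_of_inj-> //.
  - by rewrite conjgK.
  - exact: hyperbolicJ.
  - by rewrite !abs_trJ abs_trV abs_tr_flip.
by exists (U * matS)%g; rewrite form_of_conj // conjgM E.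
Qed.

Lemma form_act1 f : form_act 1%g f = f.
Proof. by rewrite form_act_psl sl2_act1. Qed.

Theorem corollary4p7 (M : PSL2Z) (hM : hyperbolic M) :
  ambiguous_cark (cark_of M) <->
  (forall f : form, represents M f -> ambiguous_form f).
Proof.
split=> [/(ambiguous_cark_conj hM)[U /conj_flipE E] f [V ->]|amb].
  rewrite form_of_conj //; apply/ambiguous_form_conj; first exact: hyperbolicJ.
  (* Conjugating M^V by this element gives M^(U flip(V)), the conjugate of flip(M)^-1 by flip(V),
     which is flip(M^V)^-1. *)
  exists (V^-1 * U * flip V)%g; apply/conj_flipE.
  by rewrite -!conjgM !mulgA mulgV mul1g conjgM E conjVg !conjgE !flipM flipV.
have [U E] : exists U, (U * flip M)%g = (M^-1 * U)%g.
  by apply/(ambiguous_form_conj hM)/amb; exists 1%g; rewrite form_act1.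
exact: ambiguous_cark_flip E.
Qed.
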